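(* Let $f:[-1,1]\to\mathbb{R}$ be Lipschitz. Then there is a sequence of real polynomials $\{p_n\}$, each having all of its (real or complex) critical points in $[-1,1]$, that converges uniformly to $f$ on $[-1,1]$, such that $\{p_n'\}$ is uniformly bounded on $[-1,1]$ and every subsequence of $\{p_n'\}$ diverges pointwise at Lebesgue almost every point of $[-1,1]$.
   Context: The critical points of a polynomial $p$ are the $z\in\mathbb{C}$ with $p'(z)=0$. *)

(* Defs.v *)
From mathcomp Require Export all_boot all_order all_algebra.
From mathcomp Require Export complex.
From mathcomp Require Export all_classical all_reals all_analysis.
Export Order.TTheory GRing.Theory Num.Theory.
Export numFieldNormedType.Exports.

Set Implicit Arguments.
Unset Strict Implicit.
Unset Printing Implicit Defensive.

Local Open Scope ring_scope.
Local Open Scope complex_scope.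

Section CriticalPoints.
Variable R : realType.

Definition critical_point (p : {poly R[i]}) (z : R[i]) : Prop :=
  p^`().[z] = 0.

(* Every complex number is critical for a constant polynomial, so this
   predicate excludes constants; it is vacuous in degree 1. *)
Definition critical_points_in (p : {poly R}) (A : set R) : Prop :=
  forall z : R[i], critical_point (map_poly (real_complex R) p) z ->
    exists2 x : R, A x & z = x%:C.

End CriticalPoints.

(* Main.v *)
From mathcomp Require Import zify ring lra.
From mathcomp Require Import polyrcf measurable_realfun.
Require Import Defs.

(* Take p_n = B_n + A S_n, where B_n are the Bernstein polynomials of f on
   [-1, 1] and S_n' is the Chebyshev polynomial T_(n+2).  Bernstein polynomials
   preserve the Lipschitz constant L of f, so |B_n'| <= L, while S_n -> 0
   uniformly.  If A > L, then p_n' = B_n' + A T_(n+2) has the sign of T_(n+2) at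
   its n+3 extremal points, hence has n+2 = deg p_n' roots in [-1, 1].
   If a subsequence of (p_n') converged on a set of positive measure, its terms
   would differ by at most 1 on some E of positive measure from some rank on.
   By Riemann-Lebesgue the integral over E of p_n' T_(n+2) is then at most |E|
   in the limit; but A T_(n+2)^2 contributes A |E| / 2 to it and B_n' T_(n+2) at
   least - L |E|, which is absurd as soon as A > 2 (L + 1). *)

Set Implicit Arguments.
Unset Strict Implicit.

Local Open Scope classical_set_scope.
Local Open Scope ring_scope.

Lemma eventually_div_le (R : realType) (C e : R) : 0 < e ->
  exists n0, forall n, (n0 <= n)%N -> C / n.+1%:R <= e.
Proof.
move=> e0; exists (Num.truncn (C / e)) => n nC.
rewrite ler_pdivrMr// mulrC -ler_pdivrMr//.
by apply/ltW/(lt_le_trans (truncnS_gt _)); rewrite ler_nat ltnS.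
Qed.

(** * Chebyshev polynomials and small antiderivatives of them *)

Section Chebyshev.
Variable R : realType.
Implicit Types x t : R.

Fixpoint chebT n : {poly R} :=
  if n is k.+1 then
    if k is m.+1 then 'X *+ 2 * chebT k - chebT m else 'X
  else 1.

(** Second kind; it enters only through the derivative of [chebT]. *)
Fixpoint chebU n : {poly R} :=
  if n is k.+1 then
    if k is m.+1 then 'X *+ 2 * chebU k - chebU m else 'X *+ 2
  else 1.

Lemma chebT_rec n : chebT n.+2 = 'X *+ 2 * chebT n.+1 - chebT n.
Proof. by []. Qed.

Lemma chebU_rec n : chebU n.+2 = 'X *+ 2 * chebU n.+1 - chebU n.
Proof. by []. Qed.

Lemma two_step_ind (P : nat -> Prop) :
  P 0%N -> P 1%N -> (forall n, P n -> P n.+1 -> P n.+2) -> forall n, P n.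
Proof.
move=> P0 P1 PS n; suff [] : P n /\ P n.+1 by [].
by elim: n => [//|n [Pn Pn1]]; split=> //; exact: PS.
Qed.

Lemma size_chebT n : (size (chebT n) <= n.+1)%N.
Proof.
elim/two_step_ind: n => [||n Pn Pn1]; rewrite ?size_poly1 ?size_polyX//.
rewrite chebT_rec (leq_trans (size_polyD _ _))// geq_max size_polyN.
rewrite (leq_trans Pn) ?andbT; last by rewrite -addn2 leq_addr.
rewrite mulrnAl -scaler_nat (leq_trans (size_scale_leq _ _))//.
by rewrite (leq_trans (size_polyMleq _ _))// size_polyX.
Qed.

Lemma chebT_cos n t : (chebT n).[cos t] = cos (t *+ n).
Proof.
elim/two_step_ind: n => [||n Pn Pn1]; first by rewrite mulr0n cos0 hornerE.
  by rewrite hornerX mulr1n.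
rewrite chebT_rec !hornerE Pn Pn1.
have -> : t *+ n.+2 = t *+ n.+1 + t by rewrite mulrSr.
have -> : t *+ n = t *+ n.+1 - t by rewrite mulrSr addrK.
by rewrite cosB cosD; ring.
Qed.

Lemma chebU_chebT n : chebU n.+2 - chebU n = chebT n.+2 *+ 2.
Proof.
elim/two_step_ind: n => [||n Pn Pn1]; [by rewrite /=; ring..|].
rewrite (chebU_rec n.+2) (chebT_rec n.+2) mulrnBl -mulrnAr -Pn -Pn1.
by rewrite (chebU_rec n); ring.
Qed.

Lemma deriv_chebT n : (chebT n.+1)^`() = chebU n *+ n.+1.
Proof.
elim/two_step_ind: n => [||n Pn Pn1].
- by rewrite derivX.
- by rewrite /= derivB derivC derivM derivMn derivX; ring.
rewrite (chebT_rec n.+1) derivB derivM Pn Pn1 derivMn derivX.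
have -> : 1 *+ 2 * chebT n.+2 = chebU n.+2 - chebU n by rewrite chebU_chebT; ring.
by rewrite chebU_rec; ring.
Qed.

Lemma chebT_itv x n : -1 <= x <= 1 -> `|(chebT n).[x]| <= 1.
Proof. by move=> /acosK <-; rewrite chebT_cos cos_max. Qed.

(** The identity cos^2 s = (1 + cos 2s) / 2. It splits T_n^2 into its mean 1/2 and an oscillating
    term that Riemann-Lebesgue removes. *)
Lemma chebT_double x n : -1 <= x <= 1 ->
  (chebT n).[x] ^+ 2 = 2^-1 + 2^-1 * (chebT n.*2).[x].
Proof.
by move=> /acosK <-; rewrite !chebT_cos -muln2 mulrnA cos_mulr2n; field.
Qed.

(** The classical antiderivative (T_(m+1) / (m+1) - T_(m-1) / (m-1)) / 2 of T_m, at m = n + 2 so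
    that m - 1 is never 0. *)
Definition chebS n : {poly R} :=
  2^-1 *: (n.+3%:R^-1 *: chebT n.+3 - n.+1%:R^-1 *: chebT n.+1).

Lemma deriv_chebS n : (chebS n)^`() = chebT n.+2.
Proof.
rewrite /chebS derivZ derivB !derivZ !deriv_chebT.
rewrite -(scaler_nat n.+3 (chebU n.+2)) -(scaler_nat n.+1 (chebU n)).
rewrite !scalerA !mulVf ?pnatr_eq0// !scale1r chebU_chebT.
by rewrite -(scaler_nat 2 (chebT _)) scalerA mulVf ?scale1r// pnatr_eq0.
Qed.

Lemma chebS_itv x n : -1 <= x <= 1 -> `|(chebS n).[x]| <= n.+1%:R^-1.
Proof.
move=> x1; have T3 := chebT_itv n.+3 x1; have T1 := chebT_itv n.+1 x1.
rewrite hornerZ hornerD hornerN !hornerZ normrM normfV normr_nat ler_pdivrMl//.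
rewrite (le_trans (ler_normB _ _))// !normrM !normfV !normr_nat mulr_natl mulr2n.
rewrite lerD//; last by rewrite ler_piMr ?invr_ge0.
rewrite (le_trans (ler_piMr _ T3)) ?invr_ge0// lef_pV2 ?posrE//.
by rewrite ler_nat -[X in (_ <= X)%N]addn2 leq_addr.
Qed.

End Chebyshev.

(** * Bernstein polynomials on [-1, 1] *)

Section Bernstein.
Variable R : realType.
Implicit Types (x : R) (f : R -> R) (g h : nat -> R).

(* De Casteljau's recursion for the Bernstein polynomial of degree [n] on
   [-1, 1] with control values [g 0, ..., g n]. *)
Fixpoint bern n g : {poly R} :=
  if n is m.+1 then
    (2^-1 *: (1 - 'X)) * bern m g + (2^-1 *: (1 + 'X)) * bern m (g \o S)
  else (g 0%N)%:P.

Lemma size_bern n g : (size (bern n g) <= n.+1)%N.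
Proof.
elim: n g => [|n IHn] g; first by rewrite size_polyC leq_b1.
have mulS (p q : {poly R}) : (size p <= 2)%N -> (size q <= n.+1)%N ->
    (size (2^-1 *: p * q)%R <= n.+2)%N.
  move=> p2 qn; rewrite -scalerAl (leq_trans (size_scale_leq _ _))//.
  move: p2 qn (size_polyMleq p q); move: (size p) (size q) (size (p * q)) => a b c.
  by lia.
rewrite (leq_trans (size_polyD _ _))// geq_max !mulS//.
  by rewrite addrC -polyC1 size_XaddC.
by rewrite addrC -polyC1 -size_polyN opprD opprK size_XsubC.
Qed.

Lemma bernB n g h : bern n (g \- h) = bern n g - bern n h.
Proof.
elim: n g h => [|n IHn] g h; first by rewrite /= polyCB.
rewrite [LHS]/= IHn (_ : (g \- h) \o S = (g \o S) \- (h \o S))// IHn /=.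
by rewrite !mulrBr; ring.
Qed.

Lemma deriv_bern n g :
  (bern n.+1 g)^`() = (n.+1%:R / 2) *: bern n (fun k => g k.+1 - g k).
Proof.
have dl : (2^-1 *: (1 - 'X) : {poly R})^`() = - (2^-1)%:P.
  by rewrite derivZ derivB derivX derivC sub0r scalerN alg_polyC.
have dr : (2^-1 *: (1 + 'X) : {poly R})^`() = (2^-1)%:P.
  by rewrite derivZ derivD derivX derivC add0r alg_polyC.
elim: n g => [|n IHn] g.
  rewrite /= derivD !derivM dl dr !derivC !mulr0 !addr0 -mul_polyC /=; ring.
set D := (fun k => _).
have DE : D = (g \o S) \- g by [].
rewrite [bern n.+2 g]/= -/(bern n.+1 g) -/(bern n.+1 (g \o S)).
rewrite derivD !derivM !IHn dl dr -/D.
rewrite (_ : (fun k => (g \o S) k.+1 - (g \o S) k) = D \o S)//.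
(* Differentiating the two weights contributes one more half of [bern n.+1 D], which raises the
   factor from n + 1 to n + 2. *)
have -> : (2^-1)%:P * bern n.+1 (g \o S) =
    (2^-1)%:P * bern n.+1 D + (2^-1)%:P * bern n.+1 g :> {poly R}.
  by rewrite DE bernB -mulrDr subrK.
rewrite [bern n.+1 D]/= -!mul_polyC -[n.+2]addn1 natrD.
ring.
Qed.

(** Both weights of the recursion are nonnegative on [-1, 1]. *)
Lemma le_bern n g h x : -1 <= x <= 1 -> (forall k, (k <= n)%N -> g k <= h k) ->
  (bern n g).[x] <= (bern n h).[x].
Proof.
move=> x1; elim: n g h => [|n IHn] g h gh; first by rewrite !hornerC gh.
rewrite /= !hornerE lerD// ler_wpM2l ?IHn//; try lra.
- by move=> k kn; rewrite gh// (leq_trans kn).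
- by move=> k kn; rewrite /= gh.
Qed.

(** The weights of the control values at x form the binomial law with parameters n and u, of mean n
    u and variance n u (1 - u). *)
Lemma bern_quadratic n a b c x (u := (1 + x) / 2) :
  (bern n (fun k => a + b * k%:R + c * k%:R ^+ 2)).[x] =
  a + b * (n%:R * u) + c * (n%:R * u * (1 - u) + (n%:R * u) ^+ 2).
Proof.
rewrite /u {u}; elim: n a b c => [|n IHn] a b c.
  by rewrite hornerC; ring.
rewrite /= (_ : _ \o S =
  fun k : nat => (a + b + c) + (b + c *+ 2) * k%:R + c * k%:R ^+ 2).
  rewrite -polyC1 !(hornerD, hornerM, hornerZ, hornerN, hornerC, hornerX) !IHn.
  by rewrite -[n.+1]addn1 natrD; field.
by apply/funext => k /=; rewrite -[k.+1]addn1 natrD; ring.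
Qed.

Lemma bern_cst n (c x : R) : (bern n (fun=> c)).[x] = c.
Proof.
have -> : (fun=> c) = fun k : nat => c + 0 * k%:R + 0 * k%:R ^+ 2.
  by apply/funext => k; ring.
by rewrite bern_quadratic; ring.
Qed.

Lemma norm_bern n g x M : -1 <= x <= 1 ->
  (forall k, (k <= n)%N -> `|g k| <= M) -> `|(bern n g).[x]| <= M.
Proof.
move=> x1 gM; rewrite ler_norml -[leLHS](bern_cst n _ x).
rewrite -[X in _ && (_ <= X)](bern_cst n _ x).
by rewrite !le_bern// => k /gM; rewrite ler_norml => /andP[].
Qed.

(** The degree is n + 1, so that the node spacing 2 / (n + 1) makes sense for every n. *)
Definition bernf n f := bern n.+1 (fun k => f (k%:R * (2 / n.+1%:R) - 1)).

Lemma bern_node n k : (k <= n.+1)%N -> -1 <= (k%:R * (2 / n.+1%:R) - 1 : R) <= 1.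
Proof.
move=> kn; rewrite lerBDr addNr mulr_ge0 ?divr_ge0//=.
rewrite lerBlDr mulrCA -[leRHS]mulr1 ler_wpM2l// ler_pdivrMr ?ltr0n//.
by rewrite mul1r ler_nat.
Qed.

(** By monotonicity the error is at most the Bernstein mean of the quadratic majorant [q]; the
    variance formula evaluates this mean as e + C (1 - x^2) / (n + 1). *)
Lemma bernf_approx n f (e C x : R) : 0 <= C ->
  (forall x y, -1 <= x <= 1 -> -1 <= y <= 1 ->
     `|f x - f y| <= e + C * (x - y) ^+ 2) ->
  -1 <= x <= 1 -> `|f x - (bernf n f).[x]| <= e + C / n.+1%:R.
Proof.
move=> C0 fC x1.
pose q (k : nat) : R := e + C * (x - (k%:R * (2 / n.+1%:R) - 1)) ^+ 2.
have n0 : n.+1%:R != 0 :> R by rewrite pnatr_eq0.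
have qE : (bern n.+1 q).[x] = e + C * (1 - x ^+ 2) / n.+1%:R.
  rewrite /q (_ : (fun k : nat => _) = fun k => (e + C * (x + 1) ^+ 2) +
      (- C * (x + 1) * 2 * (2 / n.+1%:R)) * k%:R +
      (C * (2 / n.+1%:R) ^+ 2) * k%:R ^+ 2).
    by rewrite bern_quadratic; field.
  by apply/funext => k; ring.
have qle : (bern n.+1 q).[x] <= e + C / n.+1%:R.
  rewrite qE lerD2l ler_wpM2r ?invr_ge0// ler_piMr// gerBl; exact: sqr_ge0.
have B k : (k <= n.+1)%N -> `|f x - f (k%:R * (2 / n.+1%:R) - 1)| <= q k.
  by move=> kn; apply: fC => //; exact: bern_node.
rewrite (le_trans _ qle)// -(bern_cst n.+1 (f x) x) /bernf -hornerN -hornerD -bernB.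
rewrite ler_norml lerNl -hornerN.
have -> : - bern n.+1 ((fun=> f x) \- (fun k => f (k%:R * (2 / n.+1%:R) - 1))) =
   bern n.+1 ((fun k => f (k%:R * (2 / n.+1%:R) - 1)) \- (fun=> f x)).
  by rewrite !bernB opprB.
by rewrite !le_bern// => k /B; rewrite ler_norml lerNl => /andP[]; rewrite ?opprB.
Qed.

(** The derivative has as control values the differences of f at neighbouring nodes, at most 2 L /
    (n + 1), times the factor (n + 1) / 2. *)
Lemma deriv_bernf_lipschitz n f L x :
  (forall x y, -1 <= x <= 1 -> -1 <= y <= 1 -> `|f x - f y| <= L * `|x - y|) ->
  -1 <= x <= 1 -> `|(bernf n f)^`().[x]| <= L.
Proof.
move=> fL x1; have n0 : n.+1%:R != 0 :> R by rewrite pnatr_eq0.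
rewrite /bernf deriv_bern hornerZ normrM ger0_norm ?divr_ge0//.
have -> : L = n.+1%:R / 2 * (L * (2 / n.+1%:R)) by field.
rewrite ler_wpM2l ?divr_ge0// norm_bern// => k kn.
rewrite (le_trans (fL _ _ _ _)) ?bern_node ?(leq_trans kn)//.
rewrite (_ : _ - _ = 2 / n.+1%:R) ?ger0_norm ?divr_ge0//.
by rewrite -[k.+1]addn1 natrD; ring.
Qed.

End Bernstein.

(** * Locating all roots by sign alternation *)

(** The intermediate value theorem puts a root in each of n disjoint open intervals. As the degree
    is at most n, these are all the roots, complex ones included. *)
Lemma alternating_roots (R : realType) (q : {poly R}) n (t : nat -> R) :
  (size q <= n.+1)%N ->
  (forall k l, (k < l)%N -> (l <= n)%N -> t l < t k) ->
  (forall k, (k <= n)%N -> -1 <= t k <= 1) ->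
  (forall k, (k <= n)%N -> 0 < (-1) ^+ k * q.[t k]) ->
  forall z : R[i], (map_poly (real_complex R) q).[z] = 0 ->
    exists2 x : R, -1 <= x <= 1 & z = (x%:C)%C.
Proof.
move=> sq t_lt t1 q_alt.
have root_between k : exists r, (k < n)%N -> [/\ t k.+1 < r, r < t k & root q r].
  (* [choice] requires a value at every index; 0 is a dummy for k >= n. *)
  have [kn|] := ltnP k n; last by exists 0.
  have tk : t k.+1 < t k by exact: t_lt.
  have qk : q.[t k.+1] * q.[t k] < 0.
    have := mulr_gt0 (q_alt k.+1 kn) (q_alt k (ltnW kn)).
    by rewrite mulrACA exprS mulN1r mulNr -expr2 sqrr_sign mulN1r oppr_gt0.
  have [r] := poly_ivtoo (ltW tk) qk.
  by rewrite inE => /andP[? ?] ?; exists r.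
have [r rP] := choice root_between.
pose rs := [seq r k | k <- iota 0 n].
have urs : uniq rs.
  rewrite map_inj_in_uniq ?iota_uniq// => k l; rewrite !mem_iota !add0n /=.
  have rlt a b : (a < b)%N -> (b < n)%N -> r b < r a.
    move=> ab bn; have [_ rb _] := rP b bn; have [ra _ _] := rP a (ltn_trans ab bn).
    rewrite (lt_trans rb)// (le_lt_trans _ ra)//.
    have [->//|ba] := eqVneq a.+1 b; apply/ltW/t_lt; lia.
  move=> kn ln rkl; have [kl|kl|//] := ltngtP k l.
    by have := rlt _ _ kl ln; rewrite rkl ltxx.
  by have := rlt _ _ kl kn; rewrite rkl ltxx.
have rrs : all (root q) rs.
  by apply/allP => _ /mapP[k + ->]; rewrite mem_iota add0n => /rP[].
have q0 : q != 0.
  by apply/eqP => q0; have := q_alt 0%N isT; rewrite q0 horner0 mulr0 ltxx.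
have szrs : size rs = n by rewrite size_map size_iota.
have sqE : size q = (size rs).+1.
  apply/eqP; rewrite eqn_leq szrs sq /=.
  by have := max_poly_roots q0 rrs urs; rewrite szrs.
(* So q is a nonzero scalar times the product of the X - r_k, a factorisation that carries over to
   R[i]. *)
move=> z; rewrite (all_roots_prod_XsubC sqE rrs) ?uniq_rootsE//.
rewrite map_polyZ rmorph_prod /= hornerZ => /eqP; rewrite mulf_eq0 => /orP[|].
  by rewrite fmorph_eq0 lead_coef_eq0 (negPf q0).
have -> : \prod_(x <- rs) map_poly (real_complex R) ('X - x%:P) =
    \prod_(y <- map (real_complex R) rs) ('X - y%:P).
  by rewrite big_map; apply: eq_bigr => x _; rewrite map_polyXsubC.
rewrite -rootE root_prod_XsubC => /mapP[_ /mapP[k + ->] ->].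
rewrite mem_iota add0n => /andP[_ kn]; exists (r k) => //.
have [tr rt _] := rP k kn.
have /andP[t1k _] := t1 k.+1 kn; have /andP[_ tk1] := t1 k (ltnW kn).
by rewrite (ltW (le_lt_trans t1k tr)) (ltW (lt_le_trans rt tk1)).
Qed.

(** * A Riemann-Lebesgue lemma for Chebyshev polynomials *)

Section RiemannLebesgue.
Variable R : realType.
Notation mu := (@lebesgue_measure R).
Implicit Types (x : R) (f : R -> R) (E : set (measurableTypeR R)).
Implicit Types p : {poly R}.

Let I : set (measurableTypeR R) := `[(-1)%R, 1%R]%classic.

Let mI : measurable I. Proof. exact: measurable_itv. Qed.

Let inI x : I x -> -1 <= x <= 1.
Proof. by rewrite /I /= in_itv. Qed.

Lemma lebesgue_measure_sub_segment E :
  measurable E -> E `<=` I -> (mu E <= (2 : R)%:E)%E.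
Proof.
move=> mE EI; have -> : (2 : R)%:E = mu I.
  by rewrite lebesgue_measure_itv /= lte_fin gtrN// -EFinB opprK.
by apply: le_measure; rewrite ?inE.
Qed.

Lemma horner_bounded p :
  exists2 M, 0 <= M & forall x, -1 <= x <= 1 -> `|p.[x]| <= M.
Proof.
elim/poly_ind: p => [|p c [M M0 pM]].
  by exists 0 => // x _; rewrite horner0 normr0.
exists (M + `|c|); first exact: addr_ge0.
move=> x x1; rewrite hornerMXaddC (le_trans (ler_normD _ _))// lerD2r normrM.
by rewrite -[leRHS]mulr1 ler_pM ?pM// ler_norml.
Qed.

(* The set of [C] that work for [x] contains a neighbourhood of infinity,
   locally uniformly in [x]; compactness makes this uniform. *)
Lemma continuous_modulus f (e : R) : continuous f -> 0 < e ->
  exists2 C : R, 0 <= C &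
    forall x y, -1 <= x <= 1 -> -1 <= y <= 1 ->
      `|f x - f y| <= e + C * (x - y) ^+ 2.
Proof.
move=> cf e0; have [M fM] : exists M, forall x, -1 <= x <= 1 -> `|f x| <= M.
  have cnf : {within `[-1, 1], continuous (fun x => `|f x|)}.
    by apply: continuous_subspaceT => x; apply: cvg_norm; exact: cf.
  have [c _ fc] := EVT_max (ltW (gtrN ltr01)) cnf.
  by exists `|f c| => x x1; apply: fc; rewrite in_itv.
have /compact_near_coveringP cover := @segment_compact R (-1) 1.
have [|C0 [_ CP]] := cover _ (pinfty_nbhs R) (fun C x => -1 <= x <= 1 ->
   forall y, -1 <= y <= 1 -> `|f x - f y| <= e + C * (x - y) ^+ 2) _; last first.
  exists (Num.max 0 (C0 + 1)); first by rewrite le_max lexx.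
  move=> x y x1 y1.
  by apply: CP => //=; rewrite ?in_itv// lt_max ltrDl ltr01 orbT.
move=> x _; have /cvgrPdist_le /(_ (e / 2) (divr_gt0 e0 (ltr0n _ 2))) := cf x.
move=> /nbhs_ballP[d /= d0 fd].
have d20 : 0 < d / 2 by rewrite divr_gt0.
have fd' z : `|x - z| < d -> `|f x - f z| <= e / 2 by move=> xz; apply: fd.
(* If |x - y| < d, both values are within e / 2 of f x. Otherwise |x' - y| >= d / 2, and the choice
   of C makes the quadratic term at least 2 M. *)
exists (ball x (d / 2), [set C | 2 * M / (d / 2) ^+ 2 <= C]) => /=.
  split; first exact: nbhsx_ballx.
  exact/nbhs_pinfty_ge/num_real.
move=> [x' C] /= [xx' CM] x1' y y1.
have fMM : `|f x' - f y| <= 2 * M.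
  by rewrite (le_trans (ler_normB _ _))// mulr_natl mulr2n lerD// fM.
have M0 : 0 <= M by rewrite (le_trans _ (fM _ y1)).
have C0 : 0 <= C by rewrite (le_trans _ CM)// divr_ge0 ?sqr_ge0// mulr_ge0.
have [xy|xy] := ltP `|x - y| d.
  rewrite (@le_trans _ _ e)//; last by rewrite lerDl mulr_ge0// sqr_ge0.
  rewrite (le_trans (ler_distD (f x) _ _))// [leRHS](splitr e) lerD ?fd'//.
  by rewrite distrC fd'// (lt_trans xx')// ltr_pdivrMr// ltr_pMr// ltr1n.
have dxy : d / 2 <= `|x' - y|.
  have := ler_distD x' x y; have : `|x - x'| < d / 2 := xx'.
  by move: xy; rewrite {2}(splitr d); lra.
rewrite (le_trans fMM)// (@le_trans _ _ (C * (d / 2) ^+ 2))//.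
  by rewrite -ler_pdivrMr ?exprn_gt0.
rewrite -[leLHS]add0r lerD ?(ltW e0)// ler_wpM2l// -(real_normK (num_real (x' - y))).
by rewrite ler_sqr ?nnegrE// ltW.
Qed.

(** Weierstrass approximation by Bernstein polynomials: half of [e] pays for the modulus of
    continuity, half for the term C / (n + 1). *)
Lemma poly_approx f (e : R) : continuous f -> 0 < e ->
  exists p : {poly R}, forall x, -1 <= x <= 1 -> `|f x - p.[x]| <= e.
Proof.
move=> cf e0; have [C C0 fC] := continuous_modulus cf (divr_gt0 e0 (ltr0n _ 2)).
have [n /(_ n (leqnn n)) Cn] := eventually_div_le C (divr_gt0 e0 (ltr0n _ 2)).
exists (bernf n f) => x x1; rewrite (le_trans (bernf_approx _ C0 fC x1))//.
by rewrite [leRHS](splitr e) lerD2l.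
Qed.

Lemma bounded_integrable E f M : measurable E -> E `<=` I ->
  measurable_fun E f -> (forall x, E x -> `|f x| <= M) -> mu.-integrable E (EFin \o f).
Proof.
move=> mE E1 mf fM; apply: measurable_bounded_integrable => //.
  by rewrite (le_lt_trans (lebesgue_measure_sub_segment mE E1))// ltry.
exists M; split; first exact: num_real.
by move=> N MN x Ex; exact: le_trans (fM x Ex) (ltW MN).
Qed.

Lemma horner_integrable E p : measurable E -> E `<=` I ->
  mu.-integrable E (EFin \o horner p).
Proof.
move=> mE E1; have [M _ pM] := horner_bounded p.
apply: (@bounded_integrable _ _ M) => //.
  exact: measurable_poly.
by move=> x /E1 /inI; exact: pM.
Qed.

Lemma Rintegral_deriv p :
  \int[mu]_(x in I) p^`().[x] = p.[1] - p.[-1].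
Proof.
rewrite /Rintegral (@continuous_FTC2 _ _ (horner p))//.
- by apply: continuous_subspaceT; exact: continuous_horner.
- split.
  + by move=> x _; exact: derivable_horner.
  + by apply: cvg_at_right_filter; exact: continuous_horner.
  + by apply: cvg_at_left_filter; exact: continuous_horner.
- by move=> x _; rewrite derivE.
Qed.

Lemma Rintegral_norm_le E f M : measurable E -> E `<=` I ->
  measurable_fun E f -> (forall x, E x -> `|f x| <= M) -> 0 <= M ->
  `|\int[mu]_(x in E) f x| <= 2 * M.
Proof.
move=> mE E1 mf fM M0.
have intf : mu.-integrable E (EFin \o f) by exact: bounded_integrable fM.
have mnf : measurable_fun E (fun x => `|f x|) by exact: measurableT_comp.
have muE := lebesgue_measure_sub_segment mE E1.
rewrite (le_trans (le_normr_Rintegral _ _))//.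
rewrite (@le_trans _ _ (\int[mu]_(x in E) M))//.
  apply: le_Rintegral => //.
    by apply: (@bounded_integrable _ _ M) => // x Ex; rewrite normr_id fM.
  by apply: (@bounded_integrable _ _ M) => // x Ex; rewrite ger0_norm.
rewrite Rintegral_cst// mulrC ler_wpM2r// -lee_fin fineK//.
by rewrite ge0_fin_numE// (le_lt_trans muE)// ltry.
Qed.

(** Integration by parts against [chebS], which is O(1/n): the boundary terms give 2 M, the
    remaining integral 2 M'. *)
Lemma Rintegral_horner_chebT p : exists2 C, 0 <= C & forall n,
  `|\int[mu]_(x in I) (p * chebT R n.+2).[x]| <= C / n.+1%:R.
Proof.
have [M M0 pM] := horner_bounded p; have [M' M'0 p'M] := horner_bounded p^`().
exists (2 * M + 2 * M'); first by rewrite addr_ge0 ?mulr_ge0.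
move=> n; have II : I `<=` I by [].
have -> : p * chebT R n.+2 = (p * chebS R n)^`() - p^`() * chebS R n.
  by rewrite derivM deriv_chebS [X in X - _]addrC addrK.
under eq_Rintegral do rewrite hornerD hornerN.
rewrite RintegralB//; [|exact: horner_integrable..].
rewrite Rintegral_deriv mulrDl (le_trans (ler_normB _ _))// lerD//.
  have PS x : -1 <= x <= 1 -> `|(p * chebS R n).[x]| <= M / n.+1%:R.
    by move=> x1; rewrite hornerM normrM ler_pM// ?pM// chebS_itv.
  rewrite (le_trans (ler_normB _ _))// mulr_natl mulr2n mulrDl.
  by rewrite lerD// PS//; apply/andP; split; lra.
rewrite -mulrA; apply: Rintegral_norm_le => //.
- exact: measurable_poly.
- move=> x /inI x1; rewrite hornerM normrM.
  by rewrite ler_pM// ?p'M// chebS_itv.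
- by rewrite mulr_ge0 ?invr_ge0.
Qed.

Lemma integrable_dist E f g : measurable E ->
  mu.-integrable E (EFin \o f) -> mu.-integrable E (EFin \o g) ->
  mu.-integrable E (EFin \o (fun x => `|f x - g x|)).
Proof.
move=> mE intf intg.
have : mu.-integrable E (EFin \o (f \- g)) by exact: (integrableB mE intf intg).
by move/integrable_norm.
Qed.

(** Continuous functions are dense in L^1, and polynomials approximate them uniformly. *)
Lemma indic_poly_approx E (e : R) : measurable E -> 0 < e ->
  exists P : {poly R}, \int[mu]_(x in I) `|\1_E x - P.[x]| <= e.
Proof.
move=> mE e0; have e30 : 0 < e / 3 by rewrite divr_gt0.
have int1 : mu.-integrable I (EFin \o (\1_E : R -> R)).
  apply: (@bounded_integrable _ _ 1) => // x _.
  by rewrite indicE; case: (x \in E); rewrite ?normr1 ?normr0.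
have muIoo : (mu I < +oo)%E.
  by rewrite (le_lt_trans (lebesgue_measure_sub_segment mI _))// ltry.
have [g [cg intg /fine_cvgP[_ /cvgrPdist_le /(_ _ e30) [k _ /(_ k (leqnn k))]]]] :=
  approximation_continuous_integrable mI muIoo int1.
rewrite /= sub0r normrN => gk.
have [P gP] := poly_approx (cg k) e30; exists P.
have intP := horner_integrable P mI (@subset_refl _ I).
have int1g : mu.-integrable I (EFin \o (fun x => `|\1_E x - g k x|)).
  exact: integrable_dist.
have intgP : mu.-integrable I (EFin \o (fun x => `|g k x - P.[x]|)).
  exact: integrable_dist.
have int1P : mu.-integrable I (EFin \o (fun x => `|\1_E x - P.[x]|)).
  exact: integrable_dist.
rewrite (@le_trans _ _ (\int[mu]_(x in I) (`|\1_E x - g k x| + `|g k x - P.[x]|)))//.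
  apply: le_Rintegral => //; last by move=> x _; exact: ler_distD.
  exact: (integrableD mI int1g intgP).
(* The factor 2 is the length of [-1, 1]. *)
rewrite RintegralD// (_ : e = e / 3 + 2 * (e / 3)); last by lra.
rewrite lerD//; first by rewrite (le_trans (ler_norm _)).
rewrite (le_trans (ler_norm _))// Rintegral_norm_le ?(ltW e30)//.
  by apply/measurable_EFinP; case/integrableP: intgP.
by move=> x /inI /gP; rewrite normr_id.
Qed.

(** Replace the indicator of E by a polynomial P close in L^1. The error is controlled because p
    T_(n+2) is bounded uniformly in n; the term with P is O(1/n) by parts. *)
Lemma riemann_lebesgue_chebT E p (e : R) : measurable E -> E `<=` I -> 0 < e ->
  exists n0, forall n, (n0 <= n)%N ->
    `|\int[mu]_(x in E) (p * chebT R n.+2).[x]| <= e.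
Proof.
move=> mE E1 e0; have [M M0 pM] := horner_bounded p.
(* M may be 0, so the division is by M + 1. *)
have M1 : 0 < M + 1 by rewrite ltr_wpDl.
have d0 : 0 < e / 2 / (M + 1) by rewrite !divr_gt0.
have [P EP] := indic_poly_approx mE d0.
have [C C0 PC] := Rintegral_horner_chebT (P * p).
have [n0 Cn0] := eventually_div_le C (divr_gt0 e0 (ltr0n _ 2)).
exists n0 => n /Cn0 Cn.
pose h x := (\1_E x - P.[x]) * (p * chebT R n.+2).[x].
have pTM x : -1 <= x <= 1 -> `|(p * chebT R n.+2).[x]| <= M + 1.
  move=> x1; rewrite hornerM normrM (le_trans (ler_pM _ _ (pM x x1) (chebT_itv _ x1)))//.
  by rewrite mulr1 lerDl.
have mPE : measurable_fun I (fun x => \1_E x - P.[x]).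
  by apply: measurable_funB; [exact: measurable_indic|exact: measurable_poly].
have [B B0 PB] := horner_bounded P.
have PEB x : I x -> `|\1_E x - P.[x]| <= 1 + B.
  move=> /inI x1; rewrite (le_trans (ler_normB _ _))// lerD ?PB//.
  by rewrite indicE; case: (x \in E); rewrite ?normr1 ?normr0.
have inth : mu.-integrable I (EFin \o h).
  apply: (@bounded_integrable _ _ ((1 + B) * (M + 1))) => //.
    by apply: measurable_funM => //; exact: measurable_poly.
  by move=> x Ix; rewrite /h normrM ler_pM// ?PEB ?pTM// inI.
have intPE : mu.-integrable I (EFin \o (fun x => `|\1_E x - P.[x]|)).
  apply: (@bounded_integrable _ _ (1 + B)) => //; first exact: measurableT_comp.
  by move=> x Ix; rewrite normr_id PEB.
have -> : \int[mu]_(x in E) (p * chebT R n.+2).[x] =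
    \int[mu]_(x in I) (h x + (P * p * chebT R n.+2).[x]).
  rewrite -[in LHS](setIidr E1) Rintegral_mkcondr; apply: eq_Rintegral => x _.
  rewrite /h patchE -mulrA [(P * _).[x]]hornerM -mulrDl subrK indicE.
  by case: (x \in E); rewrite ?mul1r ?mul0r.
rewrite RintegralD//; last exact: horner_integrable.
rewrite (le_trans (ler_normD _ _))// [leRHS](splitr e) lerD//; last first.
  exact: le_trans (PC n) Cn.
rewrite (le_trans (le_normr_Rintegral _ _))//.
rewrite (@le_trans _ _ (\int[mu]_(x in I) (`|\1_E x - P.[x]| * (M + 1))))//.
  apply: le_Rintegral => //.
  - by apply: integrable_norm.
  - apply: (@bounded_integrable _ _ ((1 + B) * (M + 1))) => //.
      by apply: measurable_funM => //; exact: measurableT_comp.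
    move=> x Ix; rewrite normrM normr_id (ger0_norm (ltW M1)).
    by rewrite ler_wpM2r ?(ltW M1) ?PEB.
  - by move=> x Ix; rewrite /h normrM ler_wpM2l// pTM// inI.
by rewrite RintegralZr// -ler_pdivlMr.
Qed.

End RiemannLebesgue.

(** * Divergence almost everywhere *)

Section Divergence.
Variable R : realType.
Notation mu := (@lebesgue_measure R).
Implicit Types (x L A : R) (q : nat -> {poly R}).

(** Comparison with the fixed polynomial [q 0] lets Riemann-Lebesgue apply with a factor independent
    of n. The map [N] gives the frequencies along a subsequence. *)
Lemma near_constant_null q (r : nat -> {poly R}) (N : nat -> nat) L A
    (E : set (measurableTypeR R)) :
  measurable E -> E `<=` `[-1, 1] -> (forall n, (n <= N n)%N) ->
  (forall n, q n = r n + A *: chebT R (N n).+2) ->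
  (forall n x, -1 <= x <= 1 -> `|(r n).[x]| <= L) -> 2 * (L + 1) < A ->
  (forall n x, E x -> `|(q n).[x] - (q 0%N).[x]| <= 1) -> mu E = 0%E.
Proof.
move=> mE E1 nN qE rL LA qq.
have muE : (mu E < +oo)%E.
  by rewrite (le_lt_trans (lebesgue_measure_sub_segment mE E1))// ltry.
have muEfin : mu E \is a fin_num by rewrite ge0_fin_numE.
rewrite -(fineK muEfin); congr (_%:E); apply/eqP; rewrite eq_le fine_ge0// andbT.
have A0 : 0 < A / 2 - (L + 1) by lra.
have L0 : 0 <= L by rewrite (le_trans _ (rL 0%N 0 _))// ?normr_ge0// lerN10 ler01.
have Ap : 0 < A / 2 by lra.
(* It suffices to show (A / 2 - (L + 1)) |E| <= e for every e > 0. *)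
rewrite -(pmulr_rle0 _ A0); apply/ler_addgt0Pr => e e0; rewrite add0r.
have e20 : 0 < e / 2 by rewrite divr_gt0.
have [n1 P1] := riemann_lebesgue_chebT (q 0%N) mE E1 e20.
have [n2 P2] := riemann_lebesgue_chebT ((A / 2)%:P) mE E1 e20.
pose n := maxn n1 n2; have nNn := nN n.
have {}P1 := P1 (N n) (leq_trans (leq_maxl _ _) nNn).
have {P2} : `|\int[mu]_(x in E) ((A / 2)%:P * chebT R (N n).+2.*2).[x]| <= e / 2.
  by rewrite doubleS; apply: P2; lia.
set P := q 0%N * _ in P1; set Q := _ * chebT R _.*2 => P2.
have intP := horner_integrable P mE E1; have intQ := horner_integrable Q mE E1.
have intC (c : R) : mu.-integrable E (EFin \o fun=> c).
  by apply: (@bounded_integrable _ _ _ `|c|).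
(* With m = N n + 2, |(A T_m - q_0) T_m| <= L + 1 on E, and A T_m^2 = A / 2 + (A / 2) T_(2m). This
   bounds the constant pointwise by P - Q, whose two integrals are at most e / 2 each. *)
have : \int[mu]_(x in E) (A / 2 - (L + 1)) <= \int[mu]_(x in E) (P.[x] - Q.[x]).
  apply: le_Rintegral => //; first exact: (integrableB mE intP intQ).
  move=> x Ex; have x1 : -1 <= x <= 1 by have := E1 x Ex; rewrite /= in_itv.
  have := chebT_double (N n).+2 x1; have := chebT_itv (N n).+2 x1.
  have := qq n x Ex; have := rL n x x1; rewrite qE /P /Q.
  move: (chebT R (N n).+2) (chebT R (N n).+2.*2) => T T2.
  rewrite !hornerD !hornerZ !hornerM hornerC.
  move: (r n).[x] (q 0%N).[x] T.[x] T2.[x] => rx q0 t t2 rxL qL t1 tt.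
  have -> : t2 = 2 * t ^+ 2 - 1 by rewrite tt; lra.
  have : `|(rx + A * t - q0 - rx) * t| <= 1 + L.
    by rewrite normrM -[leRHS]mulr1 ler_pM// (le_trans (ler_normB _ _))// lerD//.
  by rewrite ler_norml => /andP[_]; rewrite expr2; lra.
rewrite Rintegral_cst// => /le_trans; apply.
rewrite RintegralB// (le_trans (ler_norm _))// (le_trans (ler_normB _ _))//.
by rewrite [leRHS](splitr e) lerD.
Qed.

(** A point of convergence lies in some [E K], where all terms from rank K on stay within 1 of the
    K-th; each [E K] is null, and there are countably many. *)
Lemma ae_diverge (r : nat -> {poly R}) (N : nat -> nat) L A :
  (forall n, (n <= N n)%N) ->
  (forall n x, -1 <= x <= 1 -> `|(r n).[x]| <= L) -> 2 * (L + 1) < A ->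
  {ae mu, forall x, x \in `[-1, 1] ->
     ~ cvgn (fun n => (r n + A *: chebT R (N n).+2).[x])}.
Proof.
move=> nN rL LA; pose q n := r n + A *: chebT R (N n).+2.
pose E K : set (measurableTypeR R) := `[(-1)%R, 1%R] `&`
  \bigcap_n [set x | `|(q (n + K)%N - q K).[x]| <= 1].
have mE K : measurable (E K).
  apply: measurableI; first exact: measurable_itv.
  apply: bigcapT_measurable => n.
  rewrite (_ : [set x | _] =
    setT `&` horner (q (n + K)%N - q K) @^-1` `[(-1)%R, 1%R]).
    by apply: measurable_poly => //; exact: measurable_itv.
  by rewrite setTI; apply/seteqP; split => x; rewrite /= in_itv /= ler_norml.
apply: (@negligibleS _ _ _ _ (\bigcup_K E K)) => [x /=|]; last first.
  apply: negligible_bigcup => K; exists (E K); split => //.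
  apply: (@near_constant_null (fun n => q (n + K)%N) (fun n => r (n + K)%N)
    (fun n => N (n + K)%N) L A) => //.
  - by move=> x [].
  - by move=> n; rewrite (leq_trans _ (nN _))// leq_addr.
  - by move=> n x x1; exact: rL.
  - by move=> n x [_ /(_ n I)]; rewrite /= hornerD hornerN.
(* Being within 1/2 of the limit from rank K on puts the terms within 1 of each other. *)
move=> /not_implyP[x1 /contrapT /cvg_ex[l /cvgrPdist_le /(_ (1 / 2) ltac:(lra))]].
move=> [K _ Kl]; exists K => //; split; first by [].
move=> n _ /=; rewrite hornerD hornerN.
have := Kl K (leqnn K); have := Kl (n + K)%N (leq_addl n K); rewrite /= -!/(q _).
by rewrite !ler_norml => /andP[? ?] /andP[? ?]; apply/andP; split; lra.
Qed.

End Divergence.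

(** * Construction of the sequence and its four properties *)

Theorem corollary12p2 (R : realType) (f : R -> R)
    (f_lip : [lipschitz f x | x in `[-1, 1]]) :
  exists p : nat -> {poly R},
    [/\ forall n, critical_points_in (p n) `[-1, 1],
        {uniform `[-1, 1], (fun n (x : R) => (p n).[x]) @ \oo --> f},
        exists M : R, forall n (x : R),
          x \in `[-1, 1] -> `|(p n)^`().[x]| <= M
      & forall phi : nat -> nat, {homo phi : m n / (m < n)%N} ->
          {ae (@lebesgue_measure R), forall x : R,
            x \in `[-1, 1] -> ~ cvgn (fun n => (p (phi n))^`().[x])}].
Proof.
have [L L0 fL] : exists2 L, 0 <= L & forall x y, -1 <= x <= 1 -> -1 <= y <= 1 ->
    `|f x - f y| <= L * `|x - y|.
  (* [f_lip] yields every constant beyond some threshold; the maximum with 0 is a nonnegative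
     one. *)
  case: f_lip => L [_ /(_ (Num.max (L + 1) 0))].
  rewrite lt_max ltrDl ltr01 => /(_ isT) fL.
  exists (Num.max (L + 1) 0); first by rewrite le_max lexx orbT.
  by move=> x y x1 y1; apply: (fL (x, y)); split; rewrite /= in_itv.
(* Beyond 2 (L + 1) for the divergence, hence beyond L for the sign alternation. *)
pose A := 2 * (L + 1) + 1; have A0 : 0 < A by rewrite /A; lra.
pose r n := (bernf n f)^`(); pose q n := r n + A *: chebT R n.+2.
pose p n := bernf n f + A *: chebS R n.
have pq n : (p n)^`() = q n by rewrite derivD derivZ deriv_chebS.
have rL n x : -1 <= x <= 1 -> `|(r n).[x]| <= L by exact: deriv_bernf_lipschitz.
have inI (x : R) : x \in `[-1, 1] -> -1 <= x <= 1 by rewrite ?inE /= ?in_itv.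
exists p; split.
- move=> n z; rewrite /critical_point deriv_map pq => qz.
  (* The n + 3 extremal points of T_(n+2), where it equals (-1)^k; they decrease as k grows. *)
  pose t k : R := cos (pi / n.+2%:R *+ k).
  have tI k : (k <= n.+2)%N -> pi / n.+2%:R *+ k \in `[0, pi : R].
    move=> kn; rewrite in_itv /= mulrn_wge0 ?divr_ge0 ?pi_ge0//=.
    rewrite -mulr_natr mulrAC ler_pdivrMr ?ltr0n// ler_wpM2l ?pi_ge0//.
    by rewrite ler_nat.
  have [||||x x1 ->] := @alternating_roots R (q n) n.+2 t _ _ _ _ z qz.
  + rewrite (leq_trans (size_polyD _ _))// geq_max.
    rewrite (leq_trans (size_scale_leq _ _)) ?size_chebT// andbT.
    rewrite (leq_trans (size_poly _ _))// (leq_trans (leq_pred _))//.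
    exact: leq_trans (size_bern _ _) _.
  + move=> k l kl ln; rewrite /t ltr_cos ?tI// ?(leq_trans (ltnW kl))//.
    by rewrite ltr_pMn2l // divr_gt0 ?pi_gt0.
  + by move=> k _; rewrite cos_geN1 cos_le1.
  + move=> k kn; rewrite hornerD hornerZ chebT_cos -mulrnA mulnC mulrnA.
    rewrite -(mulr_natr (_ / _)) divfK ?pnatr_eq0//.
    have -> : cos (pi *+ k) = (-1) ^+ k :> R.
      elim: (k) => [|j IHj]; first by rewrite mulr0n cos0.
      by rewrite mulrSr cosDpi IHj exprS mulN1r.
    rewrite mulrDr mulrCA -expr2 sqrr_sign mulr1.
    (* The alternating value is A + (-1)^k r_n(t_k) >= A - L > 0. *)
    have : - ((-1) ^+ k * (r n).[t k]) <= L.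
      by rewrite (le_trans (ler_norm _))// normrN normrMsign rL// cos_geN1 cos_le1.
    by rewrite /A; lra.
  + by exists x => //=; rewrite in_itv.
- move=> P /uniform_nbhs [B [+ BP]]; rewrite -entourage_ballE => -[e /= e0 eB].
  (* Completing the square gives L d <= e / 4 + (L^2 / e) d^2, the form of modulus that
     [bernf_approx] takes. *)
  pose C := L ^+ 2 / e; have C0 : 0 <= C by rewrite divr_ge0 ?sqr_ge0 ?ltW.
  have fC x y : -1 <= x <= 1 -> -1 <= y <= 1 ->
      `|f x - f y| <= e / 4 + C * (x - y) ^+ 2.
    move=> x1 y1; rewrite (le_trans (fL _ _ x1 y1))// -(real_normK (num_real (x - y))).
    rewrite -subr_ge0 (_ : _ - _ = (e / 2 - L * `|x - y|) ^+ 2 / e); last first.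
      by rewrite /C; field; rewrite gt_eqF.
    by rewrite divr_ge0 ?sqr_ge0 ?ltW.
  (* The total error is then at most e / 4 + e / 2 < e. *)
  have [n0 CAn0] := eventually_div_le (C + A) (divr_gt0 e0 (ltr0n _ 2)).
  exists n0 => // n /CAn0 CAn.
  apply: BP => y /= yI; have y1 : -1 <= y <= 1 by move: yI; rewrite in_itv.
  apply: eB => /=; rewrite /ball /= hornerD hornerZ opprD addrA.
  rewrite (le_lt_trans (ler_normB _ _))// normrM gtr0_norm//.
  have := bernf_approx n C0 fC y1.
  have : A * `|(chebS R n).[y]| <= A / n.+1%:R.
    by rewrite ler_wpM2l ?(ltW A0)// chebS_itv.
  move: CAn; rewrite mulrDl.
  by move: (C / _) (A / _) (A * `|_|) `|f y - _| => a b c d; lra.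
- exists (L + A) => n x /inI x1; rewrite pq hornerD hornerZ.
  rewrite (le_trans (ler_normD _ _))// lerD ?rL// normrM gtr0_norm//.
  by rewrite ler_piMr ?(ltW A0)// chebT_itv.
- move=> phi phi_lt.
  have : {ae (@lebesgue_measure R), forall x : R, x \in `[-1, 1] ->
      ~ cvgn (fun n => (r (phi n) + A *: chebT R (phi n).+2).[x])}.
    apply: (@ae_diverge R (r \o phi) phi L A).
    (* A strictly increasing [phi] satisfies n <= phi n. *)
    + elim=> // n IHn; exact: leq_ltn_trans IHn (phi_lt _ _ (ltnSn n)).
    + by move=> n x; exact: rL.
    + by rewrite /A; lra.
  apply: negligibleS => x; apply: contra_not => Hx x1.
  by under eq_fun => n do rewrite pq; exact: Hx.
Qed.
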